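(* Let $m$ and $e$ be integers with $2\le e\le m$. If $S\in\mathcal{C}(m,e)$, $P\in[S]$ and $(H,P)$ is an edge of $G([S])$, then $F(P)\leq F(H)$ and $g(P)<g(H)$.
   Context: $\mathbb{N}=\{0,1,2,\ldots\}$. A numerical semigroup is a subset $S\subseteq\mathbb{N}$ closed under addition, with $0\in S$ and $\mathbb{N}\setminus S$ finite. The multiplicity $m(S)$ is the least positive integer in $S$. The Frobenius number $F(S)$ is the greatest integer not in $S$, and the genus $g(S)$ is the cardinality of $\mathbb{N}\setminus S$. Every numerical semigroup has a unique minimal (with respect to inclusion) system of generators, which is finite; it is denoted $\mathrm{msg}(S)$, and its cardinality $e(S)$ is the embedding dimension of $S$. $M(S)$ denotes the maximum of $\mathrm{msg}(S)$. $\mathcal{L}(m,e)$ is the set of all numerical semigroups with multiplicity $m$ and embedding dimension $e$. A numerical semigroup $S$ is packed if $\mathrm{msg}(S)\subseteq\{m(S),m(S)+1,\ldots,2m(S)-1\}$; $\mathcal{C}(m,e)$ is the set of packed numerical semigroups in $\mathcal{L}(m,e)$. For $S\in\mathcal{L}(m,e)$, $\phi(S)$ denotes the numerical semigroup generated by $\{m+(x\bmod m)\mid x\in\mathrm{msg}(S)\}$, where $x\bmod m\in\{0,\ldots,m-1\}$ is the remainder of $x$ upon division by $m$; and $[S]=\{T\in\mathcal{L}(m,e)\mid \phi(T)=\phi(S)\}$. For $S\in\mathcal{C}(m,e)$, $G([S])$ is the directed graph whose vertex set is $[S]$ and in which $(A,B)\in[S]\times[S]$ is an edge if and only if $\mathrm{msg}(B)=(\mathrm{msg}(A)\setminus\{M(A)\})\cup\{M(A)-m\}$.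 *)

(* Defs.v *)
(* MathComp world (with classical sets). *)
From mathcomp Require Export all_boot all_order all_algebra finmap.
From mathcomp Require Export mathcomp_extra boolp classical_sets cardinality.

Set Implicit Arguments.
Unset Strict Implicit.
Unset Printing Implicit Defensive.

Local Open Scope classical_set_scope.
Local Open Scope nat_scope.

Definition submonoid (S : set nat) : Prop :=
  S 0 /\ (forall x y, S x -> S y -> S (x + y)).

Definition numerical_semigroup (S : set nat) : Prop :=
  submonoid S /\ finite_set (~` S).

Definition generated (X : set nat) : set nat := smallest submonoid X.

(* The default values of [xget] below are only reached when no extremum
   (resp. no minimal system of generators) exists. *)
Definition least d (T : porderType d) (x0 : T) (A : set T) : T :=
  xget x0 (A `&` lbound A).

Definition greatest d (T : porderType d) (x0 : T) (A : set T) : T :=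
  xget x0 (A `&` ubound A).

Definition multiplicity (S : set nat) : nat := least 0 [set x | S x /\ 0 < x].

(* Integer-valued: the greatest integer outside S is -1 when S is all of nat. *)
Definition Frobenius (S : set nat) : int :=
  greatest 0%R [set z : int | ~ exists2 n : nat, S n & z = n%:Z%R].

Definition genus (S : set nat) : nat := #|` fset_set (~` S)|.

Definition minimal_generators (S : set nat) : set (set nat) :=
  [set X | generated X = S /\
           forall Y, Y `<=` X -> generated Y = S -> Y = X].

Definition msg (S : set nat) : set nat := xget set0 (minimal_generators S).

Definition embdim (S : set nat) : nat := #|` fset_set (msg S)|.

Definition max_msg (S : set nat) : nat := greatest 0 (msg S).

Definition semigroups (m e : nat) : set (set nat) :=
  [set S | [/\ numerical_semigroup S, multiplicity S = m & embdim S = e]].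

Definition packed (S : set nat) : Prop :=
  msg S `<=` [set x | multiplicity S <= x <= 2 * multiplicity S - 1].

Definition packed_semigroups (m e : nat) : set (set nat) :=
  [set S | semigroups m e S /\ packed S].

Definition phi (m : nat) (S : set nat) : set nat :=
  generated [set m + x %% m | x in msg S].

Definition phi_class (m e : nat) (S : set nat) : set (set nat) :=
  [set T | semigroups m e T /\ phi m T = phi m S].

(* Edge set of the directed graph G([S]) on the vertex set [phi_class m e S].
   The subtraction never truncates: m belongs to msg(A), so m <= max_msg A. *)
Definition graph_edges (m e : nat) (S : set nat) : set (set nat * set nat) :=
  [set AB | [/\ phi_class m e S AB.1, phi_class m e S AB.2 &
     msg AB.2 = (msg AB.1 `\ max_msg AB.1) `|` [set max_msg AB.1 - m]]].

(* Main.v *)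
Require Import Defs.

(** Since [M(H) = (M(H) - m) + m] and [m] lies in [P], every minimal generator
    of [H] lies in [P], so [H] is contained in [P].  The inclusion is strict:
    if [M(H) - m] were in [H], then [M(H)] would be a sum of two smaller
    elements of [H], hence a redundant generator.  Thus the gaps of [P] form a
    proper subset of those of [H]. *)

Set Implicit Arguments.
Unset Strict Implicit.

Import Order.TTheory GRing.Theory Num.Theory.
Local Open Scope classical_set_scope.
Local Open Scope nat_scope.

Lemma generated_submonoid (X : set nat) : submonoid (generated X).
Proof.
split=> [A [[A0 _] _] //|x y Xx Xy A AX].
by have [[_ Aadd] _] := AX; apply: Aadd; [apply: Xx | apply: Xy].
Qed.

Lemma sub_generated (X : set nat) : X `<=` generated X.
Proof. by move=> x Xx A [_ XA]; exact: XA. Qed.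

Lemma generated_min (X A : set nat) :
  submonoid A -> X `<=` A -> generated X `<=` A.
Proof. by move=> Am XA x; apply. Qed.

Lemma generated_sub_eq (X Y : set nat) :
  Y `<=` X -> X `<=` generated Y -> generated Y = generated X.
Proof.
move=> YX XY; apply/seteqP; split; apply: generated_min => //.
- exact: generated_submonoid.
- exact: subset_trans YX (@sub_generated X).
- exact: generated_submonoid.
Qed.

(** Otherwise [X] without [x] would still generate [S], and minimality would force it to equal [X],
    which contains [x]. *)
Lemma minimal_generators_irredundant (S X : set nat) (x : nat) :
  minimal_generators S X -> X x -> ~ generated (X `\ x) x.
Proof.
move=> [XS Xmin] Xx gx.
have XDX : X `\ x `<=` X by move=> y [].
have XsubG : X `<=` generated (X `\ x).
  move=> y Xy; have [-> //|yx] := pselect (y = x).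
  exact: sub_generated.
have := Xmin _ XDX; rewrite (generated_sub_eq XDX XsubG) => /(_ XS) XE.
by move: Xx; rewrite -XE => -[_]; apply.
Qed.

(** Summands in nat never exceed their sum, so a sum below [x] cannot use [x]. Hence the implication
    guarded by [z < x] defines a submonoid containing [X]. *)
Lemma generated_setD1_lt (X : set nat) (x y : nat) :
  generated X y -> y < x -> generated (X `\ x) y.
Proof.
have [G0 Gadd] := generated_submonoid (X `\ x).
apply: (@generated_min X [set z | z < x -> generated (X `\ x) z]).
  split=> [_ //|a b /= Ga Gb abx].
  apply: Gadd; [apply: Ga | apply: Gb]; apply: leq_ltn_trans abx.
    exact: leq_addr.
  exact: leq_addl.
move=> z Xz /= zx; apply: sub_generated; split=> // zE.
by move: zx; rewrite zE ltnn.
Qed.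

Lemma minimal_generators_neq0 (S X : set nat) :
  minimal_generators S X -> ~ X 0.
Proof.
move=> XS X0; apply: (minimal_generators_irredundant XS X0).
by have [] := generated_submonoid (X `\ 0).
Qed.

(** Both summands are smaller than [x + y], so each is generated without it, which would make
    [x + y] redundant. *)
Lemma minimal_generators_indecomposable (S X : set nat) (x y : nat) :
  minimal_generators S X -> S x -> S y -> 0 < x -> 0 < y -> ~ X (x + y).
Proof.
move=> XS Sx Sy x0 y0 Xxy.
apply: (minimal_generators_irredundant XS Xxy).
have [gXS _] := XS.
have [_ Gadd] := generated_submonoid (X `\ (x + y)).
apply: Gadd; apply: generated_setD1_lt; rewrite ?gXS //.
  by rewrite -[ltnLHS]addn0 ltn_add2l.
by rewrite -[ltnLHS]add0n ltn_add2r.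
Qed.

(* A positive embedding dimension excludes both junk values: the default
   [set0] of [msg] and the empty [fset_set] of an infinite set. *)
Lemma embdim_gt0_msg (S : set nat) : 0 < embdim S ->
  [/\ minimal_generators S (msg S), finite_set (msg S) & msg S !=set0].
Proof.
rewrite /embdim => S0.
have [fin|inf] := pselect (finite_set (msg S)); last first.
  by move: S0; rewrite /fset_set; case: pselect => // _; rewrite cardfs0.
have mn0 : msg S !=set0.
  apply/set0P/eqP => m0; by rewrite m0 fset_set0 cardfs0 in S0.
split=> //; move: mn0; rewrite /msg.
by case: xgetP => [X -> //|_ []].
Qed.

(** Positivity excludes the default value 0 of [least]. *)
Lemma multiplicity_in (S : set nat) :
  0 < multiplicity S -> S (multiplicity S).
Proof. by rewrite /multiplicity /least; case: xgetP => [x -> [[]]|]. Qed.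

Lemma bounded_nat_has_greatest (A : set nat) (n : nat) :
  A !=set0 -> ubound A n -> exists k, (A `&` ubound A) k.
Proof.
move=> [a Aa] An.
have exA : exists k, `[< A k >] by exists a; apply/asboolP.
have bA k : `[< A k >] -> k <= n by move=> /asboolP/An.
have [k /asboolP Ak kmax] := ex_maxnP exA bA.
by exists k; split=> // l Al; apply: kmax; apply/asboolP.
Qed.

Lemma finite_nat_bounded (A : set nat) :
  finite_set A -> exists n, ubound A n.
Proof.
move=> fA; exists (\max_(i <- fset_set A) i) => x Ax.
apply: (@leq_bigmax_seq _ _ xpredT id) => //.
by rewrite in_fset_set // inE.
Qed.

Lemma greatestP d (T : porderType d) (x0 : T) (A : set T) :
  (exists x, (A `&` ubound A) x) -> (A `&` ubound A) (greatest x0 A).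
Proof. by move=> [x Ax]; apply: (xgetPex x0); exists x. Qed.

Lemma max_msg_in (S : set nat) : 0 < embdim S -> msg S (max_msg S).
Proof.
move=> /embdim_gt0_msg[_ /finite_nat_bounded[n Sn] S0].
by have [] := greatestP 0 (bounded_nat_has_greatest S0 Sn).
Qed.

(* The gaps in [int] include all negative integers; shifting by one makes the
   relevant ones, those at least -1, range over [nat]. *)
Lemma Frobenius_greatest (S : set nat) : finite_set (~` S) ->
  let A := [set z : int | ~ exists2 n : nat, S n & z = n%:Z%R] in
  (A `&` ubound A) (Frobenius S).
Proof.
move=> /finite_nat_bounded[n Sn] A; apply: greatestP.
(* The witness [k = 0] stands for -1, which is a gap of every [S]. *)
have B0 : [set k : nat | A (k%:Z - 1)%R] !=set0 by exists 0; case.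
have Bn : ubound [set k : nat | A (k%:Z - 1)%R] n.+1.
  case=> [//|k] /= Ak; suff: k <= n by []; apply: Sn => Sk; apply: Ak.
  by exists k => //; rewrite intS addrAC subrr add0r.
have [k [Ak kub]] := bounded_nat_has_greatest B0 Bn.
exists (k%:Z - 1)%R; split=> // z Az.
(* A gap below -1 lies below [k - 1] anyway; any other gap is the shift of the natural number
   [z + 1]. *)
have [z0|z0] := leP 0%R (z + 1)%R; last first.
  by rewrite lerBrDr (le_trans (ltW z0)).
rewrite lerBrDr -(gez0_abs z0) lez_nat; apply: kub => /=.
by rewrite gez0_abs // addrK.
Qed.

Lemma Frobenius_subset (S T : set nat) :
  finite_set (~` S) -> finite_set (~` T) -> S `<=` T ->
  (Frobenius T <= Frobenius S)%R.
Proof.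
move=> /Frobenius_greatest[_ Sub] /Frobenius_greatest[Tgap _] ST.
by apply: Sub => -[n Sn FE]; apply: Tgap; exists n => //; exact: ST.
Qed.

Lemma genus_proper (S T : set nat) :
  finite_set (~` S) -> S `<` T -> genus T < genus S.
Proof.
move=> fS [ST nTS]; have CTS : ~` T `<=` ~` S by apply: subsetC.
have fT := sub_finite_set CTS fS.
apply: fproper_ltn_card; rewrite fproperE; apply/andP; split.
  by rewrite -fset_set_sub.
by apply/negP; rewrite -fset_set_sub // => /subsetCP.
Qed.

Theorem proposition11 (m e : nat) (hme : (2 <= e <= m)%N)
  (S : set nat) (hS : packed_semigroups m e S)
  (P H : set nat) (hP : phi_class m e S P)
  (hHP : graph_edges m e S (H, P)) :
  (Frobenius P <= Frobenius H)%R /\ (genus P < genus H)%N.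
Proof.
have /andP[e2 em] := hme; have e0 : 0 < e := ltnW e2.
have m0 : 0 < m := leq_trans e0 em.
case: hHP => -[[[HM fH] mH eH] _] [[[PM fP] mP eP] _] /= msgP.
have H0 : 0 < embdim H by rewrite eH.
have P0 : 0 < embdim P by rewrite eP.
have [Hmin _ _] := embdim_gt0_msg H0.
have [Pmin _ _] := embdim_gt0_msg P0.
have MH := max_msg_in H0.
have Hm : H m by rewrite -mH; apply: multiplicity_in; rewrite mH.
have Pm : P m by rewrite -mP; apply: multiplicity_in; rewrite mP.
have [genH _] := Hmin; have [genP _] := Pmin.
have msgPP : msg P `<=` P by rewrite -{2}genP; exact: sub_generated.
(* This difference is a minimal generator of [P], hence nonzero. Positivity also shows that the
   subtraction does not truncate. *)
have Mm0 : 0 < max_msg H - m.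
  rewrite lt0n; apply/eqP => M0; apply: (minimal_generators_neq0 Pmin).
  by rewrite msgP; right; rewrite /= M0.
have mM : m <= max_msg H by apply: ltnW; rewrite -subn_gt0.
have PMm : P (max_msg H - m) by apply: msgPP; rewrite msgP; right.
have nHMm : ~ H (max_msg H - m).
  move=> HMm; apply: (minimal_generators_indecomposable Hmin HMm Hm) => //.
  by rewrite subnK.
have HP : H `<=` P.
  rewrite -genH; apply: generated_min => // x Hx.
  have [->|xM] := pselect (x = max_msg H).
    by rewrite -(subnK mM); apply: PM.2.
  by apply: msgPP; rewrite msgP; left.
split; first exact: Frobenius_subset.
(* The element [max_msg H - m] of [P] is missing from [H], so the inclusion is strict. *)
by apply: genus_proper => //; split=> // /(_ _ PMm).
Qed.
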